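(* Let $k\geq 1$ be an integer and let $G$ be a finite simple forest on vertex set $\{x_1,\dots,x_n\}$ with $\operatorname{mat}(G)\geq k$; let $\Bbbk$ be a field and $S=\Bbbk[x_1,\dots,x_n]$. Then $\operatorname{reg}(I(G)^{[k]})=2k$ if and only if $\operatorname{aim}(G,k)=k$.
   Context: $I(G)\subseteq S$ is the edge ideal, generated by $x_ix_j$ for edges $\{x_i,x_j\}$ of $G$. $\operatorname{mat}(G)$ is the matching number. $I(G)^{[k]}$ is the ideal generated by the products $e_1\cdots e_k$ over all matchings $\{e_1,\dots,e_k\}$ of size $k$ (edge $\{x_i,x_j\}$ identified with $x_ix_j$). $\operatorname{reg}$ is Castelnuovo–Mumford regularity. Two edges form a gap if they are disjoint and no edge of $G$ joins a vertex of one to a vertex of the other. A sequence $(a_1,\dots,a_n)$ of integers is $k$-admissable if $a_i\ge1$ for all $i$ and $\sum a_i\le n+k-1$. For $1\le k\le\operatorname{mat}(G)$, a matching $M$ is $k$-admissable if there are nonempty pairwise disjoint $M_1,\dots,M_r\subseteq M$ with union $M$ such that edges from different $M_i$'s always form a gap in $G$, $(|M_1|,\dots,|M_r|)$ is $k$-admissable, and the induced subgraph of $G$ on $\bigcup_{e\in M_i}e$ is a forest for each $i$. $\operatorname{aim}(G,k)$ is the maximum size of a $k$-admissable matching ($0$ if none). *)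

(* Defs.v *)
From HB Require Import structures.
From mathcomp Require Import all_boot all_order all_algebra.
Set Implicit Arguments. Unset Strict Implicit. Unset Printing Implicit Defensive.
Import GRing.Theory.

Definition simple_graph n (E : {set {set 'I_n}}) : bool :=
  [forall e in E, #|e| == 2].

Definition adj n (E : {set {set 'I_n}}) : rel 'I_n :=
  fun u v => [set u; v] \in E.

(* A cycle has at most n distinct vertices, so the vertex sequence is an
   m-tuple with m <= n; this makes the predicate boolean. *)
Definition has_cycle_in n (E : {set {set 'I_n}}) (V : {set 'I_n}) : bool :=
  [exists m : 'I_n.+1, exists s : m.-tuple 'I_n,
    [&& uniq s, 3 <= size s, all (fun v => v \in V) s & cycle (adj E) s]].

Definition induced_forest n (E : {set {set 'I_n}}) (V : {set 'I_n}) : bool :=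
  ~~ has_cycle_in E V.

Definition forest n (E : {set {set 'I_n}}) : bool := induced_forest E setT.

Definition matching n (E : {set {set 'I_n}}) (M : {set {set 'I_n}}) : bool :=
  (M \subset E) &&
  [forall e in M, forall f in M, (e != f) ==> [disjoint e & f]].

Definition mat n (E : {set {set 'I_n}}) : nat :=
  \max_(M : {set {set 'I_n}} | matching E M) #|M|.

Definition gap n (E : {set {set 'I_n}}) (e f : {set 'I_n}) : bool :=
  [disjoint e & f] && [forall u in e, forall v in f, ~~ adj E u v].

Definition kadm_seq (k : nat) (s : seq nat) : bool :=
  all (fun a => 0 < a) s && (sumn s <= size s + k - 1).

Definition kadm_matching n (E : {set {set 'I_n}}) (k : nat)
    (M : {set {set 'I_n}}) : bool :=
  matching E M &&
  [exists P : {set {set {set 'I_n}}},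
     [&& partition P M,
         [forall Mi in P, forall Mj in P, (Mi != Mj) ==>
            [forall e in Mi, forall f in Mj, gap E e f]],
         kadm_seq k [seq #|Mi| | Mi : {set {set 'I_n}} <- enum P] &
         [forall Mi in P, induced_forest E (cover Mi)]]].

Definition aim n (E : {set {set 'I_n}}) (k : nat) : nat :=
  \max_(M : {set {set 'I_n}} | kadm_matching E k M) #|M|.

(* A monomial x^b of S = F[x_1..x_n] is an exponent vector b. A monomial
   ideal is described by the set of monomials it contains (an upward closed
   predicate); as an F-vector space it is spanned by these monomials. *)
Definition monom n := {ffun 'I_n -> nat}.

Definition divides_sq n (A : {set 'I_n}) (b : monom n) : bool :=
  [forall v in A, 0 < b v].

(* membership of x^b in I(G)^[k]: x^b is divisible by e_1...e_k for some
   matching {e_1,...,e_k} of size k *)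
Definition in_sqpow n (E : {set {set 'I_n}}) (k : nat) (b : monom n) : bool :=
  [exists M : {set {set 'I_n}},
     [&& matching E M, #|M| == k & divides_sq (cover M) b]].

(* Tor_i(I, F) in multidegree a is computed as the homology of the Koszul
   complex K(x_1..x_n) (free resolution of F = S/(x)) tensored with I,
   in multidegree a.  Its i-th chain space has basis e_A (x) x^(a - 1_A)
   for A subset of [n], |A| = i, x_A | x^a and x^(a-1_A) in I. *)
Definition kbasis n (inI : pred (monom n)) (a : monom n) (A : {set 'I_n}) : bool :=
  divides_sq A a && inI [ffun v => a v - (v \in A)].

Section Koszul.
Variables (F : fieldType) (n : nat) (inI : pred (monom n)) (a : monom n).

Definition sidx := 'I_#|{set 'I_n}|.
Definition sval_of (p : sidx) : {set 'I_n} := enum_val p.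

(* Koszul differential d(e_A (x) m) = sum_{v in A} (-1)^{#{u in A, u < v}}
   e_{A\v} (x) x_v m, as a matrix acting on row vectors indexed by all
   subsets; rows outside the basis are zero. *)
Definition kdiff : 'M[F]_#|{set 'I_n}| :=
  (\matrix_(p, q)
    if kbasis inI a (sval_of p) then
      \sum_(v in sval_of p | sval_of q == sval_of p :\ v)
         (-1) ^+ #|[set u in sval_of p | (u < v)%N]|
    else 0)%R.

Definition kdiff_deg (i : nat) : 'M[F]_#|{set 'I_n}| :=
  \matrix_(p, q) if #|sval_of p| == i then kdiff p q else 0%R.

Definition kchain_dim (i : nat) : nat :=
  #|[set A : {set 'I_n} | kbasis inI a A & #|A| == i]|.

Definition tor_dim (i : nat) : nat :=
  kchain_dim i - \rank (kdiff_deg i) - \rank (kdiff_deg i.+1).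
End Koszul.

Definition betti_nz (F : fieldType) n (inI : pred (monom n)) (i : nat)
  (a : monom n) : Prop := tor_dim F inI a i <> 0%N.

Definition mdeg n (a : monom n) : nat := \sum_(v < n) a v.

(* reg(I) = r  :<=>  r = max { j - i : beta_{i,j}(I) != 0 },
   where beta_{i,j} = sum_{|a| = j} beta_{i,a}. *)
Definition is_reg (F : fieldType) n (inI : pred (monom n)) (r : int) : Prop :=
  (exists i a, betti_nz F inI i a /\ (Posz (mdeg a) - Posz i)%R = r) /\
  (forall i a, betti_nz F inI i a -> (Posz (mdeg a) - Posz i <= r)%R).

(* Main.v *)
Require Import Defs.
From mathcomp Require Import all_boot all_order all_algebra.
Set Implicit Arguments. Unset Strict Implicit. Unset Printing Implicit Defensive.
Import GRing.Theory Num.Theory.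

(* In a squarefree multidegree with support [U], the Koszul homology of
   I(G)^[k] is the homology of the complex of those A <= U for which
   G[U \ A] still has a k-matching; in any other multidegree the complex is a
   cone. The regularity is at most 2k iff all these complexes have homology
   only in cells of size |U| - 2k or more.

   If aim(G,k) > k, there is a matching of size k+1 that splits into two
   nonempty parts with gaps across; on its vertex set, the 1-cycle p - q with
   p, q on different sides is not a boundary, by parity.

   If there is no such matching, one inducts on |U|. A longest path yields a
   leaf x whose neighbour y has at most one non-leaf neighbour z. The complex
   is decomposed at y (the link is a cone over x), then at x (the deletion is
   the complex of U - {x,y} for k-1), and, if y has no other leaf, the link of
   x is decomposed at z. A k-matching of U - {x,y,z} would form a split
   matching together with xy, so the remaining link is empty. *)

(** * Chain complexes of set systems *)

Section Chains.
Local Open Scope ring_scope.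
Variables (F : fieldType) (n : nat).
Implicit Types (x y v w : 'I_n) (A B U : {set 'I_n}).
Notation chain := {ffun {set 'I_n} -> F}.
Implicit Types (b c : chain) (D : pred {set 'I_n}).

(** For [v] outside [B] this is the Koszul sign of the face [B] of [v |: B]; the exponent is the
    same whether counted in [B] or in [v |: B]. *)
Definition sg v B : F := (-1) ^+ #|[set u in B | (u < v)%N]|.

Lemma sg_sqr v B : sg v B * sg v B = 1.
Proof. by rewrite -expr2 sqrr_sign. Qed.

Lemma sgU1 v w B : w \notin B -> sg v (w |: B) = (-1) ^+ (w < v)%N * sg v B.
Proof.
move=> wB; rewrite /sg -exprD; congr (_ ^+ _).
have [lt_wv|le_vw] /= := boolP (w < v)%N.
  have -> : [set u in w |: B | (u < v)%N] = w |: [set u in B | (u < v)%N].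
    by apply/setP=> u; rewrite !inE; case: eqP => [->|]; rewrite ?lt_wv.
  by rewrite cardsU1 inE (negPf wB).
rewrite add0n; congr #|pred_of_set _|; apply/setP=> u; rewrite !inE.
by case: eqP => [->|//]; rewrite (negPf le_vw) !andbF.
Qed.

Lemma sg_swap v w B : v != w -> v \notin B -> w \notin B ->
  sg v B * sg w (v |: B) = - (sg w B * sg v (w |: B)).
Proof.
move=> vw vB wB; rewrite !sgU1 // mulrCA [sg w B * _]mulrCA [sg w B * _]mulrC.
have := vw; rewrite -(inj_eq val_inj) /= neq_ltn.
by case: ltngtP => //= _ _; rewrite ?expr0 ?expr1 ?mul1r ?mulN1r ?opprK.
Qed.

(** Antisymmetry alone gives [S = -S], which says nothing in characteristic 2. So the diagonal is
    assumed to vanish and the terms are cancelled in pairs, ordered by [enum_rank]. *)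
Lemma sum_antisym (I : finType) (f : I -> I -> F) :
    (forall i, f i i = 0) -> (forall i j, f i j = - f j i) ->
  \sum_i \sum_j f i j = 0.
Proof.
move=> f0 fN.
have E i : \sum_j f i j =
    \sum_(j | (enum_rank i < enum_rank j)%N) f i j
    + \sum_(j | (enum_rank j < enum_rank i)%N) f i j.
  rewrite (bigID (fun j => (enum_rank i < enum_rank j)%N)) /=; congr (_ + _).
  rewrite (bigID (fun j => j == i)) /= addrC [X in _ + X]big1 ?addr0.
    apply: eq_bigl => j; rewrite -leqNgt ltn_neqAle andbC; congr (_ && _).
    by rewrite (inj_eq val_inj) (inj_eq enum_rank_inj).
  by move=> j /andP[_ /eqP->].
under eq_bigr do rewrite E.
rewrite big_split /= [X in _ + X](exchange_big_dep predT) //=.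
rewrite -big_split big1 //= => i _; rewrite -big_split big1 //= => j _.
by rewrite [f j i]fN subrr.
Qed.

(** The Koszul boundary read coefficientwise: the value at [B] collects the cells having [B] as a
    face. Chains live on all subsets; a set system enters only through [supported]. *)
Definition bd c : chain :=
  [ffun B : {set 'I_n} => \sum_(v | v \notin B) sg v B * c (v |: B)].

(** Contraction by [x], which carries the cells containing [x] to the link of [x]. *)
Definition con x c : chain :=
  [ffun B : {set 'I_n} => if x \in B then 0 else sg x B * c (x |: B)].

(** Exterior multiplication by [x]. The composite [ext x (con x c)] is the part of [c] on cells
    containing [x]. *)
Definition ext x c : chain :=
  [ffun B : {set 'I_n} => if x \in B then sg x (B :\ x) * c (B :\ x) else 0].

Lemma bdD b c : bd (b + c) = bd b + bd c.
Proof.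
apply/ffunP=> B; rewrite !ffunE -big_split; apply: eq_bigr => v _.
by rewrite ffunE mulrDr.
Qed.

Lemma bdN c : bd (- c) = - bd c.
Proof.
apply/ffunP=> B; rewrite !ffunE -sumrN; apply: eq_bigr => v _.
by rewrite ffunE mulrN.
Qed.

Lemma bd_bd c : bd (bd c) = 0.
Proof.
apply/ffunP=> B; rewrite !ffunE.
(* Extension by zero to all pairs turns the double boundary into an antisymmetric sum. *)
pose f v w := if [&& v \notin B, w \notin B & v != w]
  then sg v B * sg w (v |: B) * c (w |: (v |: B)) else 0.
rewrite -[RHS](@sum_antisym _ f).
- rewrite big_mkcond; apply: eq_bigr => v _; rewrite /f; case: ifPn => vB /=.
    rewrite ffunE mulr_sumr big_mkcond; apply: eq_bigr => w _.
    by rewrite !inE negb_or andbC eq_sym; case: ifP => // _; rewrite mulrA.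
  by rewrite big1.
- by move=> v; rewrite /f eqxx !andbF.
move=> v w; rewrite /f [in RHS]andbCA [w == v]eq_sym.
case: ifP => [/and3P[vB wB vw]|_]; last by rewrite oppr0.
have E : w |: (v |: B) = v |: (w |: B) by exact: setUCA.
by rewrite (sg_swap vw) // E !mulNr.
Qed.

Lemma bd_con x c : bd (con x c) = - con x (bd c).
Proof.
apply/ffunP=> B; rewrite !ffunE; case: ifPn => xB.
  by rewrite oppr0 big1 // => v _; rewrite ffunE !inE xB orbT mulr0.
rewrite mulr_sumr -sumrN (bigD1 x) //= ffunE setU11 mulr0 add0r.
apply: eq_big => v; first by rewrite !inE negb_or andbC.
case/andP=> vB vx; rewrite ffunE !inE eq_sym (negPf vx) (negPf xB) /=.
by rewrite !mulrA sg_swap 1?eq_sym // setUCA mulNr opprK.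
Qed.

(** The contracting homotopy of a cone with apex [x]: on cycles, [ext x] inverts the boundary. *)
Lemma bd_ext x c : bd (ext x c) = c - ext x (bd c).
Proof.
apply/ffunP=> B; rewrite !ffunE; case: ifPn => xB; last first.
  rewrite subr0 (bigD1 x) //= big1 ?addr0 => [|v /andP[vB vx]].
    by rewrite ffunE setU11 setU1K // mulrA sg_sqr mul1r.
  by rewrite ffunE !inE eq_sym (negPf vx) (negPf xB) mulr0.
set B' := B :\ x; have xB' : x \notin B' by rewrite !inE eqxx.
rewrite [in RHS](bigD1 x) //= [in RHS]setD1K // mulrDr mulrA sg_sqr mul1r.
rewrite opprD addrA subrr add0r.
rewrite mulr_sumr -sumrN; apply: eq_big => v.
  rewrite !inE negb_and negbK; case: eqVneq => [->|]; last by rewrite andbT.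
  by rewrite xB.
move=> vB; have vx : v != x by apply: contraNneq vB => ->.
have vB' : v \notin B' by rewrite !inE negb_and vB orbT.
rewrite ffunE !inE xB orbT /=.
have -> : (v |: B) :\ x = v |: B'.
  by apply/setP=> u; rewrite !inE; case: (eqVneq u x) => // ->; rewrite eq_sym (negPf vx).
rewrite !mulrA -[in LHS](setD1K xB) -/B' !sgU1 // -mulNr.
congr (_ * _); rewrite mulrACA [sg v B' * _]mulrC -[RHS]mulN1r; congr (_ * _).
have := vx; rewrite -(inj_eq val_inj) /= neq_ltn.
by case: ltngtP => //= _ _; rewrite ?expr0 ?expr1 ?mul1r ?mulr1.
Qed.

Definition supported c D i := forall A, c A != 0 -> D A /\ #|A| = i.

(** Degree is cardinality, with the empty set as a cell of degree 0. For a simplicial complex this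
    is the vanishing of reduced homology in dimension [i - 1]. *)
Definition exact_at D i := forall c, supported c D i -> bd c = 0 ->
  exists2 b, supported b D i.+1 & bd b = c.

Definition acyclic_below m D := forall i, (i < m)%N -> exact_at D i.

Lemma eq_exact_at D1 D2 i : D1 =1 D2 -> exact_at D1 i -> exact_at D2 i.
Proof.
move=> eD ex c cD bd0; have [|b bD <-] := ex c _ bd0.
  by move=> A /cD; rewrite eD.
by exists b => // A /bD; rewrite eD.
Qed.

Lemma eq_acyclic_below D1 D2 m : D1 =1 D2 ->
  acyclic_below m D1 -> acyclic_below m D2.
Proof. by move=> eD ac i im; apply: eq_exact_at (ac i im). Qed.

Lemma acyclic_below_empty D m : D =1 pred0 -> acyclic_below m D.
Proof.
move=> D0 i _ c cD _; exists 0 => [A|]; first by rewrite ffunE eqxx.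
apply/ffunP=> A; rewrite ffunE big1 => [|v _]; last by rewrite ffunE mulr0.
by apply/esym/eqP/negPn/negP=> /cD; rewrite D0 => -[].
Qed.

Lemma supported_ext x c D1 D2 i :
    (forall A, x \notin A -> D1 A -> D2 (x |: A)) ->
  supported c D1 i -> supported (ext x c) D2 i.+1.
Proof.
move=> D12 cD A; rewrite ffunE; case: ifPn => [xA|]; last by rewrite eqxx.
rewrite mulf_eq0 negb_or => /andP[_ /cD[DA <-]].
rewrite -[in D2 _](setD1K xA); split; last by rewrite (cardsD1 x A) xA.
by apply: D12; rewrite // !inE eqxx.
Qed.

Lemma acyclic_below_cone D x m : (forall A, D A -> D (x |: A)) ->
  acyclic_below m D.
Proof.
move=> Dx i _ c cD bd0; exists (ext x c).
  by apply: supported_ext cD => A _; apply: Dx.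
rewrite bd_ext bd0; apply/ffunP=> A; rewrite !ffunE.
by case: ifP; rewrite ?ffunE ?mulr0 subr0.
Qed.

(* Mayer-Vietoris for the decomposition of [D] into the deletion of [x] and
   the cone with apex [x] over the link of [x]. *)
Lemma acyclic_below_link D x m : (forall A, D (x |: A) -> D A) ->
  acyclic_below m (fun A => (x \notin A) && D A) ->
  acyclic_below m.-1 (fun A => (x \notin A) && D (x |: A)) ->
  acyclic_below m D.
Proof.
move=> Ddown acd acl i im c cD bd0.
(* As [con x] anticommutes with the boundary, [con x c] is a cycle of the link in degree [i - 1],
   whence the bound [m.-1] on the link; for [i = 0] it vanishes. *)
have [b1 b1D b1E] : exists2 b1,
    supported b1 (fun A => (x \notin A) && D (x |: A)) i & bd b1 = con x c.
  case: i im cD => [|i] im cD.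
    exists 0 => [A|]; first by rewrite ffunE eqxx.
    apply/ffunP=> A; rewrite !ffunE big1 => [|v _]; last by rewrite ffunE mulr0.
    case: ifPn => // xA; suff /eqP-> : c (x |: A) == 0 by rewrite mulr0.
    by apply: contraT => /cD[_]; rewrite cardsU1 xA.
  apply: acl => [|A|]; first by case: m im {acd} => [|m].
    rewrite ffunE; case: ifPn => [_|xA]; first by rewrite eqxx.
    rewrite mulf_eq0 negb_or => /andP[_ /cD[-> /eqP]].
    by rewrite cardsU1 xA => /eqP[].
  rewrite bd_con bd0; apply/ffunP=> A; rewrite !ffunE.
  by case: ifP; rewrite ?ffunE ?mulr0 oppr0.
(* The correction replaces the part of [c] on cells through [x] by [b1], which leaves a cycle of the
   deletion. *)
have c'D : supported (c + bd (ext x b1)) (fun A => (x \notin A) && D A) i.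
  move=> A; rewrite bd_ext b1E !ffunE; case: ifPn => [xA|xA] /=.
    rewrite !inE eqxx /= setD1K // mulrA sg_sqr mul1r addrC subrK.
    by move=> /b1D; rewrite xA => -[].
  rewrite subr0; have [->|/cD //] := eqVneq (c A) 0.
  by rewrite add0r => /b1D[/andP[_ /Ddown]].
have [|b0 b0D b0E] := acd i im _ c'D; first by rewrite bdD bd_bd bd0 addr0.
exists (b0 - ext x b1); last by rewrite bdD bdN b0E addrK.
have eD : supported (ext x b1) D i.+1.
  by apply: supported_ext b1D => A _ /andP[].
move=> A; have [E0|/b0D[/andP[] //]] := eqVneq (b0 A) 0.
have [E1|/eD //] := eqVneq (ext x b1 A) 0.
by rewrite ffunE E0 ffunE E1 subrr eqxx.
Qed.

End Chains.

(** * Koszul Tor dimensions as homology of set systems *)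

Section Bridge.
Local Open Scope ring_scope.
Variables (F : fieldType) (n : nat) (inI : pred (monom n)) (a : monom n).
Notation chain := {ffun {set 'I_n} -> F}.
Notation D := (kbasis inI a).
Notation K := (kdiff_deg F inI a).
Implicit Types (c b : chain) (A B : {set 'I_n}) (i : nat).

Definition vec_of_chain c : 'rV[F]_#|{set 'I_n}| := \row_p c (enum_val p).
Definition chain_of_vec (w : 'rV[F]_#|{set 'I_n}|) : chain :=
  [ffun A => w 0 (enum_rank A)].

Lemma chain_of_vecK : cancel chain_of_vec vec_of_chain.
Proof. by move=> w; apply/rowP=> p; rewrite !mxE ffunE enum_valK. Qed.

Lemma vec_of_chain0 : vec_of_chain 0 = 0.
Proof. by apply/rowP=> p; rewrite !mxE ffunE. Qed.

Lemma vec_of_chain_inj : injective vec_of_chain.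
Proof.
move=> c b /rowP E; apply/ffunP=> A.
by have := E (enum_rank A); rewrite !mxE enum_rankK.
Qed.

Definition kcells i := [set A : {set 'I_n} | D A & #|A| == i].

(** The rows are the coordinate vectors of the cells, so that [supported] becomes inclusion in a row
    space and dimensions become ranks. *)
Definition kcell_mx i : 'M[F]_(#|kcells i|, #|{set 'I_n}|) :=
  \matrix_(j, q) (enum_val q == enum_val j)%:R.

Lemma kcell_mxP i c :
  (vec_of_chain c <= kcell_mx i)%MS <-> supported c D i.
Proof.
split=> [/submxP[u uE] A cA|cD].
  have [|AN] := boolP (A \in kcells i); first by rewrite inE => /andP[-> /eqP].
  have : vec_of_chain c 0 (enum_rank A) = c A by rewrite mxE enum_rankK.
  rewrite uE mxE big1 => [c0|j _]; first by rewrite -c0 eqxx in cA.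
  rewrite mxE enum_rankK; case: eqP => [AE|_]; last by rewrite mulr0.
  by case/negP: AN; rewrite AE enum_valP.
rewrite [vec_of_chain c]row_sum_delta summx_sub // => p _.
rewrite mxE; have [->|/cD[DA /eqP cA]] := eqVneq (c (enum_val p)) 0.
  by rewrite scale0r sub0mx.
have pE : enum_val p \in kcells i by rewrite inE DA.
rewrite scalemx_sub //; apply/submxP.
exists (delta_mx 0 (enum_rank_in pE (enum_val p))); rewrite -rowE.
by apply/rowP=> q; rewrite !mxE eqxx enum_rankK_in // (inj_eq enum_val_inj).
Qed.

Lemma rank_kcell_mx i : \rank (kcell_mx i) = kchain_dim inI a i.
Proof.
rewrite /kchain_dim -/(kcells i); apply/eqP; apply/row_freeP.
exists (kcell_mx i)^T; apply/matrixP=> j l; rewrite !mxE.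
rewrite (bigD1 (enum_rank (enum_val j))) //= !mxE enum_rankK eqxx mul1r.
rewrite (inj_eq enum_val_inj) big1 ?addr0 // => q qj; rewrite !mxE.
by rewrite -[enum_val q == enum_val j](inj_eq enum_rank_inj) enum_valK (negPf qj) mul0r.
Qed.

Lemma mul_vec_kdiff i c : supported c D i ->
  vec_of_chain c *m K i = vec_of_chain (bd c).
Proof.
move=> cD; apply/rowP=> q; rewrite !mxE !ffunE /sval_of; set B := enum_val q.
rewrite (reindex (@enum_rank _)) /=; last first.
  by apply: onW_bij; exact: enum_rank_bij.
transitivity (\sum_(A : {set 'I_n}) \sum_(v in A | B == A :\ v)
    c A * (-1) ^+ #|[set u in A | (u < v)%N]|).
  apply: eq_bigr => A _; rewrite !mxE /sval_of enum_rankK.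
  have [->|/cD[DA /eqP cA]] := eqVneq (c A) 0.
    by rewrite mul0r big1 // => v _; rewrite mul0r.
  by rewrite DA cA mulr_sumr.
(* For fixed [v], the only cell containing [v] whose face without [v] is [B] is [v |: B], and it
   exists exactly when [v] is outside [B]. *)
rewrite (exchange_big_dep predT) //= [RHS]big_mkcond; apply: eq_bigr => v _.
case: ifPn => vB.
  rewrite (big_pred1 (v |: B)) => [|A].
    rewrite mulrC /sg; congr (_ * _); congr (_ ^+ _); congr #|pred_of_set _|.
    by apply/setP=> u; rewrite !inE; case: eqP => // ->; rewrite ltnn !andbF.
  apply/andP/eqP=> [[vA /eqP->]|->]; first by rewrite setD1K.
  by rewrite setU11 setU1K.
by rewrite big_pred0 // => A; apply: contraNF vB => /andP[_ /eqP->]; rewrite !inE eqxx.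
Qed.

(** Rows of [K i] outside the cells of size [i] are zero, so its whole image already comes from
    supported chains. *)
Lemma kdiff_sub_cells i : (K i <= kcell_mx i *m K i)%MS.
Proof.
apply/row_subP=> p; set A := enum_val p.
have [/andP[DA /eqP cA]|AN] := boolP (D A && (#|A| == i)).
  rewrite rowE; apply: submxMr.
  rewrite -[delta_mx 0 p]chain_of_vecK; apply/kcell_mxP => B.
  rewrite ffunE mxE eqxx /=; case: (eqVneq (enum_rank B) p) => [E _|]; last by rewrite eqxx.
  by rewrite -[B]enum_rankK E.
have -> : row p (K i) = 0; last by rewrite sub0mx.
apply/rowP=> q; rewrite !mxE; move: AN; rewrite /A /sval_of.
by case: (D _); case: eqP.
Qed.

(** Downward closure puts boundaries inside the space [Z] of supported cycles. The truncated
    difference of ranks is then 0 precisely when every cycle is a boundary. *)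
Lemma tor_dim_eq0P i : (forall v A, D (v |: A) -> D A) ->
  tor_dim F inI a i = 0%N <-> exact_at F D i.
Proof.
move=> Ddown; set Z := (kcell_mx i :&: kermx (K i))%MS.
have ZP c : (vec_of_chain c <= Z)%MS <-> supported c D i /\ bd c = 0.
  rewrite sub_capmx; split=> [/andP[/kcell_mxP cD /sub_kermxP]|[cD c0]].
    by rewrite mul_vec_kdiff // -vec_of_chain0 => /vec_of_chain_inj.
  apply/andP; split; first exact/kcell_mxP.
  by apply/sub_kermxP; rewrite mul_vec_kdiff // c0 vec_of_chain0.
have KP w : reflect (exists2 b, supported b D i.+1 & vec_of_chain (bd b) = w)
    (w <= K i.+1)%MS.
  apply: (iffP idP) => [/submx_trans/(_ (kdiff_sub_cells _))/submxP[u ->]|].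
    set b := chain_of_vec (u *m kcell_mx i.+1).
    have bD : supported b D i.+1.
      by apply/kcell_mxP; rewrite chain_of_vecK submxMl.
    by exists b; rewrite // -(mul_vec_kdiff bD) chain_of_vecK mulmxA.
  by case=> b bD <-; rewrite -(mul_vec_kdiff bD) submxMl.
have KZ : (K i.+1 <= Z)%MS.
  apply/row_subP=> p; have /KP[b bD <-] := row_sub p (K i.+1).
  apply/ZP; split; last exact: bd_bd.
  move=> A; rewrite ffunE => /eqP/eqP nz.
  have [v vA /bD[DA]] : exists2 v, v \notin A & b (v |: A) != 0.
    apply/exists_inP; apply: contraNT nz => /exists_inPn z.
    rewrite big1 // => v /z /negPn /eqP ->; exact: mulr0.
  by rewrite cardsU1 vA => -[<-]; split=> //; apply: Ddown DA.
(* Rank-nullity for [K i] restricted to the cells of size [i]. *)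
have -> : tor_dim F inI a i = (\rank Z - \rank (K i.+1))%N.
  rewrite /tor_dim -rank_kcell_mx -(mxrank_mul_ker (kcell_mx i) (K i)) -/Z.
  congr (_ - _)%N; suff -> : \rank (kcell_mx i *m K i) = \rank (K i).
    by rewrite addKn.
  by apply/eqP; rewrite eqn_leq !mxrankS ?kdiff_sub_cells ?submxMl.
have rankE : (\rank Z - \rank (K i.+1))%N = 0%N <-> (Z <= K i.+1)%MS.
  by rewrite -(mxrank_leqif_sup KZ) eqn_leq mxrankS //=; split=> /eqP.
split=> [/rankE ZK c cD c0|ex].
  have /submx_trans/(_ ZK)/KP[b bD /vec_of_chain_inj bE] :
    (vec_of_chain c <= Z)%MS by apply/ZP.
  by exists b.
apply/rankE/row_subP=> p; have := row_sub p Z; rewrite -[row p Z]chain_of_vecK.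
by case/ZP=> cD /(ex _ cD)[b bD bE]; apply/KP; exists b; rewrite ?bE.
Qed.

End Bridge.

(** * Matchings and pendant vertices of forests *)

Section Graphs.
Variables (n : nat) (E : {set {set 'I_n}}).
Hypothesis simpleE : simple_graph E.
Implicit Types (x y z u v w : 'I_n) (e f U W A : {set 'I_n}).
Implicit Types (M : {set {set 'I_n}}) (k : nat) (s p : seq 'I_n).
Notation adj := (adj E).

Lemma adj_sym : symmetric adj.
Proof. by move=> u v; rewrite /Defs.adj setUC. Qed.

Lemma card_edge e : e \in E -> #|e| = 2.
Proof. by move/forallP: simpleE => /(_ e)/implyP h /h /eqP. Qed.

Lemma adj_irrefl : irreflexive adj.
Proof.
move=> v; apply/negbTE/negP => /card_edge.
by rewrite setUid cards1.
Qed.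

Lemma edge_other e v : e \in E -> v \in e -> exists2 w, adj v w & e = [set v; w].
Proof.
move=> eE ve; have /eqP/cards2P[a [b [_ eab]]] := card_edge eE.
have /set2P[->|->] : v \in [set a; b] by rewrite -eab.
  by exists b; rewrite // /Defs.adj -eab.
by exists a; rewrite // /Defs.adj setUC -eab.
Qed.

Lemma matchingP M :
  reflect (M \subset E /\ {in M &, forall e f, e != f -> [disjoint e & f]})
    (matching E M).
Proof.
apply: (iffP andP) => -[ME d]; split=> //.
  by move=> e f eM fM; move/forall_inP/(_ e eM)/forall_inP/(_ f fM)/implyP: d.
by apply/forall_inP => e eM; apply/forall_inP => f fM; apply/implyP; apply: d.
Qed.

Lemma matching_edge M e : matching E M -> e \in M -> e \in E.
Proof. by case/matchingP=> /subsetP ME _ /ME. Qed.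

Lemma matching_eq M e f v : matching E M -> e \in M -> f \in M ->
  v \in e -> v \in f -> e = f.
Proof.
case/matchingP=> _ d eM fM ve vf; apply/eqP/contraT => /(d _ _ eM fM).
by move/pred0P/(_ v); rewrite /= ve vf.
Qed.

Lemma matchingS M M' : M' \subset M -> matching E M -> matching E M'.
Proof.
move=> /subsetP MM' /matchingP[ME d]; apply/matchingP; split.
  by apply: subset_trans ME; apply/subsetP.
by move=> e f /MM' eM /MM'; apply: d.
Qed.

Lemma mem_cover M e v : e \in M -> v \in e -> v \in cover M.
Proof. by move=> eM ve; apply/bigcupP; exists e. Qed.

Lemma coverS M M' : M' \subset M -> cover M' \subset cover M.
Proof. by move/subsetP=> MM'; apply/bigcupsP => e /MM'; apply: bigcup_sup. Qed.

Lemma coverU M M' : cover (M :|: M') = cover M :|: cover M'.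
Proof. by rewrite /cover bigcup_setU. Qed.

Lemma cover_set1 e : cover [set e] = e.
Proof. by rewrite /cover big_set1. Qed.

Lemma card_cover_matching M : matching E M -> #|cover M| = (2 * #|M|)%N.
Proof.
move=> mM; have [ME d] := matchingP _ mM.
have /eqP <- : trivIset M by apply/trivIsetP => e f eM fM /(d _ _ eM fM).
rewrite (eq_bigr (fun=> 2)) => [|e /(matching_edge mM)/card_edge //].
by rewrite sum_nat_const mulnC.
Qed.

Lemma matchingU1 M e W : matching E M -> cover M \subset W ->
    e \in E -> [disjoint e & W] ->
  matching E (e |: M) /\ #|e |: M| = #|M|.+1.
Proof.
move=> mM MW eE eW.
have eM f : f \in M -> [disjoint e & f].
  move=> fM; apply: disjointWr eW; apply: subset_trans MW.
  exact: bigcup_sup.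
have [ME d] := matchingP _ mM; split.
  apply/matchingP; split; first by rewrite subUset sub1set eE.
  move=> f g; rewrite !in_setU1 => /orP[/eqP->|fM] /orP[/eqP->|gM].
  - by rewrite eqxx.
  - by move=> _; apply: eM.
  - by move=> _; rewrite disjoint_sym; apply: eM.
  - exact: d.
rewrite cardsU1; case: (boolP (e \in M)) => // /eM; rewrite -setI_eq0 setIid.
by move/eqP=> e0; have := card_edge eE; rewrite e0 cards0.
Qed.

Lemma setD2_sub W x y : W :\ x :\ y \subset W.
Proof. by apply: subset_trans (subD1set _ _) (subD1set _ _). Qed.

Lemma disjoint_setD2 W x y : [disjoint [set x; y] & W :\ x :\ y].
Proof. by rewrite disjoints_subset subUset !sub1set !inE !eqxx /= andbF. Qed.

Definition has_kmatching k W :=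
  [exists M, [&& matching E M, #|M| == k & cover M \subset W]].

Lemma has_kmatchingP k W :
  reflect (exists M, [/\ matching E M, #|M| = k & cover M \subset W])
    (has_kmatching k W).
Proof.
apply: (iffP existsP) => [[M /and3P[mM /eqP cM MW]]|[M [mM cM MW]]];
  by exists M; rewrite ?mM ?cM ?MW ?eqxx.
Qed.

Lemma has_kmatchingS k W W' : W \subset W' ->
  has_kmatching k W -> has_kmatching k W'.
Proof.
move=> sW /has_kmatchingP[M [mM cM MW]]; apply/has_kmatchingP.
by exists M; split=> //; apply: subset_trans sW.
Qed.

Lemma matching0 : matching E set0.
Proof. by apply/matchingP; split=> [|e f]; rewrite ?sub0set ?inE. Qed.

Lemma has_kmatching0 W : has_kmatching 0 W.
Proof.
apply/has_kmatchingP; exists set0; rewrite matching0 cards0; split=> //.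
by rewrite /cover big_set0 sub0set.
Qed.

Lemma has_kmatching_isolated k W x : (forall w, w \in W -> ~~ adj x w) ->
  has_kmatching k W -> has_kmatching k (W :\ x).
Proof.
move=> isox /has_kmatchingP[M [mM cM MW]]; apply/has_kmatchingP; exists M.
split=> //; rewrite subsetD1 MW /=; apply/bigcupP => -[e eM xe].
have [w xw ew] := edge_other (matching_edge mM eM) xe.
suff wW : w \in W by have := isox w wW; rewrite xw.
by apply: (subsetP MW); apply: (mem_cover eM); rewrite ew !inE eqxx orbT.
Qed.

Definition only_nbr U x y := forall w, w \in U -> adj x w -> w = y.

(** An exchange argument: every edge at [x] passes through [y], so giving up one edge frees both
    vertices; conversely the edge [xy] can be added back. *)
Lemma has_kmatching_leaf k W x y : x \in W -> y \in W -> adj x y ->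
    only_nbr W x y ->
  has_kmatching k.+1 W = has_kmatching k (W :\ x :\ y).
Proof.
move=> xW yW xy leafx; apply/idP/idP => /has_kmatchingP[M [mM cM MW]];
    apply/has_kmatchingP.
  have xyE e : e \in M -> x \in e -> y \in e.
    move=> eM xe; have [w xw ew] := edge_other (matching_edge mM eM) xe.
    have -> : y = w.
      apply/esym/leafx => //; apply: (subsetP MW); apply: (mem_cover eM).
      by rewrite ew !inE eqxx orbT.
    by rewrite ew !inE eqxx orbT.
  (* The edge given up is the one at [y], or an arbitrary one when [y] is uncovered. *)
  have [e eM ye] : exists2 e, e \in M & forall f, f \in M -> y \in f -> f = e.
    have [/bigcupP[e eM ye]|yM] := boolP (y \in cover M).
      by exists e => // f fM yf; apply: matching_eq mM _ _ yf ye.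
    have /card_gt0P[e eM] : 0 < #|M| by rewrite cM.
    by exists e => // f fM /(mem_cover fM); rewrite (negPf yM).
  exists (M :\ e); split.
  - by apply: matchingS mM; apply: subD1set.
  - by have := cardsD1 e M; rewrite eM cM => -[].
  rewrite !subsetD1 (subset_trans (coverS (subD1set _ _)) MW) /=.
  have ye' f : f \in M :\ e -> y \notin f.
    by case/setD1P=> /eqP fe fM; apply/negP => /(ye _ fM).
  apply/andP; split; apply/bigcupP => -[f fMe]; last by apply/negP/ye'.
  by move/(xyE _ (subsetP (subD1set _ _) _ fMe)); apply/negP/ye'.
have [|m c] := @matchingU1 M [set x; y] (W :\ x :\ y) mM MW xy.
  exact: disjoint_setD2.
exists ([set x; y] |: M); split; rewrite ?c ?cM //.
rewrite coverU cover_set1 !subUset !sub1set xW yW /=.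
exact: subset_trans MW (setD2_sub _ _ _).
Qed.

(* Over the vertex set [U], [kcomplex U k] is the simplicial complex of the
   Koszul homology of [I(G)^[k]] in the squarefree multidegree [U]. *)
Definition kcomplex U k : pred {set 'I_n} :=
  fun A => (A \subset U) && has_kmatching k (U :\: A).

Definition no_split_matching U k := forall M1 M2,
  matching E (M1 :|: M2) -> cover (M1 :|: M2) \subset U ->
  M1 != set0 -> M2 != set0 ->
  {in M1 & M2, forall e f, gap E e f} -> #|M1 :|: M2| <> k.+1.

Lemma no_split_matchingS U W k : W \subset U ->
  no_split_matching U k -> no_split_matching W k.
Proof. by move=> WU nsU M1 M2 mM /subset_trans/(_ WU); apply: nsU. Qed.

Lemma gap_sym e f : gap E e f = gap E f e.
Proof.
wlog suff: e f / gap E e f -> gap E f e by move=> h; apply/idP/idP; apply: h.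
case/andP=> d /forall_inP h; rewrite /gap disjoint_sym d /=.
apply/forall_inP => u uf; apply/forall_inP => v ve; rewrite adj_sym.
by move/forall_inP: (h v ve) => /(_ u uf).
Qed.

Lemma gapP e f : reflect ({in e & f, forall u v, u != v /\ ~~ adj u v}) (gap E e f).
Proof.
apply: (iffP andP) => [[d /forall_inP h] u v ue vf|h].
  split; last by move/forall_inP: (h u ue) => /(_ v vf).
  apply: contraTneq vf => <-.
  by rewrite (disjointFr d ue).
split; last first.
  by apply/forall_inP => u ue; apply/forall_inP => v vf; case: (h u v).
apply/pred0P => v /=; apply/negP => /andP[ve vf].
by have [] := h v v ve vf; rewrite eqxx.
Qed.

(** The exceptional vertex [z] may lie outside [U] or be no neighbour of [y], which includes the
    case where [y] is the centre of a star. *)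
Definition pendant U x y := [/\ x \in U, y \in U, adj x y, only_nbr U x y &
  exists z, forall w, w \in U -> adj y w -> w <> z -> only_nbr U w y].

(** The edge [xy] is added to a side whose opposite side avoids [z]. A neighbour of [y] covered by
    that opposite side would be a leaf, matched to [y], but [y] has been removed. *)
Lemma no_split_matchingD U x y k : pendant U x y ->
  no_split_matching U k.+1 -> no_split_matching (U :\ x :\ y) k.
Proof.
case=> xU yU xy leafx [z leafz] nsU M1 M2.
(* Edges in a gap share no vertex, so at most one side covers [z]. *)
wlog zM2 : M1 M2 / z \notin cover M2.
  move=> wl mM MU M10 M20 g; have [zM2|zM2] := boolP (z \in cover M2); last exact: wl.
  rewrite setUC in mM MU *; apply: wl => // [|e f eM fM]; last first.
    by rewrite gap_sym; apply: g.
  apply/bigcupP => -[e eM ze]; case/bigcupP: zM2 => f fM zf.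
  by have /gapP/(_ z z ze zf)[] := g e f eM fM; rewrite eqxx.
move=> mM MU M10 M20 g cM.
have [|m c] := @matchingU1 _ [set x; y] _ mM MU xy.
  exact: disjoint_setD2.
rewrite setUA in m c.
apply: (nsU _ _ m) => //.
- rewrite -setUA coverU cover_set1 !subUset !sub1set xU yU /=.
  exact: subset_trans MU (setD2_sub _ _ _).
- by apply/set0Pn; exists [set x; y]; rewrite !inE eqxx.
- move=> e f; rewrite in_setU1 => /orP[/eqP->|eM] fM; last exact: g.
  apply/gapP => u v uxy vf.
  have vM2 : v \in cover M2 by apply: mem_cover vf.
  have /setD1P[vy /setD1P[vx vU]] : v \in U :\ x :\ y.
    by apply: (subsetP MU); rewrite coverU inE vM2 orbT.
  move: uxy; rewrite !inE => /orP[]/eqP->; rewrite eq_sym; split=> //.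
    by apply: contra vy => /(leafx _ vU)/eqP.
  apply/negP => yv; have vz : v <> z by move=> vz; case/negP: zM2; rewrite -vz.
  have fE : f \in E by apply: matching_edge mM _; rewrite inE fM orbT.
  have [w vw fw] := edge_other fE vf.
  have /setD1P[wy /setD1P[wx wU]] : w \in U :\ x :\ y.
    apply: (subsetP MU); apply: (@mem_cover _ f); first by rewrite inE fM orbT.
    by rewrite fw !inE eqxx orbT.
  by rewrite (leafz v vU yv vz w wU vw) eqxx in wy.
by rewrite c cM.
Qed.

(** The split consists of [xy] alone against a matching of size [k.+1] in [W], of total size
    [k.+2]. *)
Lemma no_split_matching_edge U W x y k : x \in U -> y \in U -> adj x y ->
    W \subset U :\ x :\ y ->
    (forall w, w \in W -> ~~ adj x w /\ ~~ adj y w) ->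
  no_split_matching U k.+1 -> ~~ has_kmatching k.+1 W.
Proof.
move=> xU yU xy WU isoW nsU; apply/has_kmatchingP => -[M [mM cM MW]].
have xyW : [disjoint [set x; y] & W].
  exact: disjointWr WU (disjoint_setD2 _ _ _).
have [m c] := matchingU1 mM MW xy xyW.
apply: (nsU _ _ m); rewrite ?c ?cM //.
- rewrite coverU cover_set1 !subUset !sub1set xU yU /=.
  exact: subset_trans MW (subset_trans WU (setD2_sub _ _ _)).
- by apply/set0Pn; exists [set x; y]; rewrite inE.
- by rewrite -card_gt0 cM.
move=> e f; rewrite in_set1 => /eqP-> fM; apply/gapP => u v uxy vf.
have vW : v \in W by apply: (subsetP MW); apply: mem_cover vf.
have [xv yv] := isoW v vW.
split; first by apply: contraTneq uxy => ->; rewrite (disjointFl xyW vW).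
by move: uxy; rewrite !inE => /orP[]/eqP->.
Qed.

Section Forest.
Hypothesis forestE : forest E.

Lemma forest_no_cycle s : uniq s -> 2 < size s -> cycle adj s -> False.
Proof.
move=> us s3 cs; case/negP: forestE.
have sn : size s < n.+1 by by rewrite ltnS -(card_uniqP us) -[n in _ <= n]card_ord max_card.
apply/existsP; exists (Ordinal sn); apply/existsP; exists (in_tuple s).
by rewrite /= us s3 cs andbT; apply/allP => v; rewrite inE.
Qed.

Lemma exists_pendant U u v : u \in U -> v \in U -> adj u v ->
  exists x y, pendant U x y.
Proof.
move=> uU vU uv.
pose P m := [exists s : m.-tuple 'I_n,
  [&& uniq s, all (mem U) s & sorted adj s]].
have P2 : P 2.
  apply/existsP; exists [tuple u; v]; rewrite /= uU vU inE uv !andbT.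
  by apply: contraTneq uv => ->; rewrite adj_irrefl.
have Pn m : P m -> m <= n.
  case/existsP=> s /and3P[us _ _]; rewrite -(size_tuple s).
  by rewrite -(card_uniqP us) -[n in _ <= n]card_ord max_card.
have [m /existsP[[s /= /eqP sm] /and3P[us sU ps]] mmax] := ex_maxnP (ex_intro _ 2 P2) Pn.
have {}mmax t : uniq t -> all (mem U) t -> sorted adj t -> size t <= size s.
  move=> ut tU pt; rewrite sm; apply: mmax; apply/existsP; exists (in_tuple t).
  by rewrite ut tU.
have s2 : 1 < size s by apply: (mmax [:: u; v]); rewrite /= ?uU ?vU ?uv // inE andbT;
  apply: contraTneq uv => ->; rewrite adj_irrefl.
case: s s2 us sU ps mmax {sm} => [|x [|y p]] //= _ us sU ps mmax.
(* Stated for any [x'] that can replace the first vertex of the longest path: a further neighbour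
   would close a cycle or lengthen the path. It serves for [x] and for the other neighbours of
   [y]. *)
have leaf x' : uniq [:: x', y & p] -> all (mem U) [:: x', y & p] ->
    path adj x' (y :: p) -> only_nbr U x' y.
  move=> us' sU' ps' w wU xw; apply/eqP; case: (boolP (w == y)) => // wy.
  have wx : w != x' by apply: contraTneq xw => ->; rewrite adj_irrefl.
  have [wp|wp] := boolP (w \in p).
    case: (forest_no_cycle (s := x' :: y :: rcons (take (index w p) p) w)) => //.
    - case/path.splitP: wp us' => p1 p2; rewrite -!cat_cons cat_uniq => /andP[] //.
    - by rewrite /= size_rcons.
    - case/path.splitP: wp ps' => p1 p2; rewrite /= => /andP[->].
      by rewrite cat_path => /andP[h _]; rewrite rcons_path h last_rcons adj_sym.
  suff : size [:: w, x', y & p] <= size [:: x', y & p] by rewrite ltnn.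
  apply: mmax; first by rewrite cons_uniq us' andbT !inE (negPf wx) (negPf wy).
    exact/andP.
  by rewrite /= adj_sym xw.
have [xU yU pU] : [/\ x \in U, y \in U & all (mem U) p] by case/and3P: sU.
exists x, y; split=> //; first by case/andP: ps.
  exact: leaf.
(* The exception is the successor of [y] on the path, with default [x] if the path ends at [y]. Any
   other neighbour of [y] lies off [p], since otherwise it would close a cycle, and so can replace
   [x]. *)
exists (head x p) => w wU yw wz.
have wy : w != y by apply: contraTneq yw => ->; rewrite adj_irrefl.
have py : path adj y p by case/andP: ps.
have uy : uniq (y :: p) by case/andP: us.
apply: leaf; rewrite /= ?wU ?yU ?pU ?py 1?adj_sym ?yw //= -/(uniq (y :: p)) uy andbT.
rewrite inE (negPf wy) /=; apply/negP => wp.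
case: p wp wz py uy {us sU ps mmax pU} => // z p; rewrite inE /=.
case: eqP => // _ /= wp _ py uy.
case: (forest_no_cycle (s := y :: z :: rcons (take (index w p) p) w)) => //.
- case/path.splitP: wp uy => p1 p2 uy.
  have : uniq ((y :: z :: rcons p1 w) ++ p2) by [].
  by rewrite cat_uniq => /andP[].
- by rewrite /= size_rcons.
- case/path.splitP: wp py => p1 p2; rewrite /= => /andP[->].
  by rewrite cat_path => /andP[h _]; rewrite rcons_path h last_rcons adj_sym.
Qed.

End Forest.
End Graphs.

(** * Vanishing without split matchings *)

Section Vanishing.
Variables (F : fieldType) (n : nat) (E : {set {set 'I_n}}).
Hypothesis simpleE : simple_graph E.
Implicit Types (x y z u v w : 'I_n) (U W A : {set 'I_n}).
Notation adj := (adj E).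

Definition kcomplex_del U k y : pred {set 'I_n} :=
  fun A => (y \notin A) && kcomplex E U k A.

Lemma kcomplex_down U k x A : kcomplex E U k (x |: A) -> kcomplex E U k A.
Proof.
case/andP; rewrite subUset => /andP[_ AU]; rewrite /kcomplex AU /=.
by apply: has_kmatchingS; apply: setDS; apply: subsetUr.
Qed.

Lemma setD1D U A x : U :\: A :\ x = U :\ x :\: A.
Proof. by rewrite setDDl setUC -setDDl. Qed.

Lemma setDU1 U A x : U :\: (x |: A) = U :\ x :\: A.
Proof. by rewrite setDDl. Qed.

(** When neither [x] nor [y] is in [A], both stay in [U :\: A], where [x] is still a leaf at [y];
    the edge [xy] then accounts for one matching edge. *)
Lemma kcomplex_leaf U k x y A : x \in U -> y \in U -> adj x y ->
    only_nbr E U x y ->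
  (x \notin A) && kcomplex_del U k.+1 y A = kcomplex E (U :\ x :\ y) k A.
Proof.
move=> xU yU xy leafx; rewrite /kcomplex_del /kcomplex !subsetD1.
have [xA|] /= := boolP (x \in A); first by rewrite andbF.
have [yA|yA xA] /= := boolP (y \in A); first by rewrite andbF.
rewrite !andbT (has_kmatching_leaf simpleE _ (x := x) (y := y)) ?inE ?xA ?yA //.
  by rewrite (setD1D U A x) (setD1D _ A y).
by move=> w /setDP[wU _]; apply: leafx.
Qed.

Lemma kcomplex_del_link U k x y A : x \in U -> x != y ->
  (x \notin A) && kcomplex_del U k y (x |: A) = kcomplex_del (U :\ x) k y A.
Proof.
move=> xU xy; rewrite /kcomplex_del /kcomplex subsetD1 subUset sub1set xU setDU1.
by rewrite in_setU1 negb_or [y == x]eq_sym xy /=; do !bool_congr.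
Qed.

Lemma kcomplex_acyclic_edgeless U k :
    (forall u v, u \in U -> v \in U -> ~~ adj u v) ->
  acyclic_below F (#|U| - 2 * k) (kcomplex E U k).
Proof.
move=> noE; case: k => [|k].
  (* For [k = 0] the complex is the full simplex on [U], a cone unless [U] is empty, when the bound
     is 0. For positive [k] there are no cells. *)
  have [->|[x xU]] := set_0Vmem U; first by rewrite cards0 => i.
  apply: (@acyclic_below_cone _ _ _ x) => A /andP[AU _].
  by rewrite /kcomplex subUset sub1set xU AU has_kmatching0.
apply: acyclic_below_empty => A; apply/negbTE/negP => /andP[_].
case/has_kmatchingP=> M [mM cM MU].
have /card_gt0P[e eM] : 0 < #|M| by rewrite cM.
have eE := matching_edge mM eM.
have eU u : u \in e -> u \in U.
  by move/(mem_cover eM)/(subsetP MU)/setDP=> [].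
have /card_gt0P[u ue] : 0 < #|e| by rewrite (card_edge simpleE eE).
have [v uv ev] := edge_other simpleE eE ue.
have ve : v \in e by rewrite ev !inE eqxx orbT.
by case/negP: (noE u v (eU u ue) (eU v ve)).
Qed.

Lemma kcomplex_acyclic_of_del U k : forest E ->
    (forall x y, pendant E U x y ->
      acyclic_below F (#|U| - 2 * k) (kcomplex_del U k y)) ->
  acyclic_below F (#|U| - 2 * k) (kcomplex E U k).
Proof.
move=> forestE acd.
have [/existsP[u /existsP[v /and3P[uU vU uv]]]|noE] :=
    boolP [exists u, exists v, [&& u \in U, v \in U & adj u v]]; last first.
  apply: kcomplex_acyclic_edgeless => u v uU vU; apply: contra noE => uv.
  by apply/existsP; exists u; apply/existsP; exists v; rewrite uU vU.
have [x [y pU]] := exists_pendant simpleE forestE uU vU uv.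
have ac := acd x y pU; have [xU yU xy leafx _] := pU.
apply: (@acyclic_below_link _ _ _ y) => //.
  exact: kcomplex_down.
have yx : y != x by apply: contraTneq xy => ->; rewrite adj_irrefl.
(* With [y] removed, [x] is isolated, so removing [x] as well costs no matching edge: the link of
   [y] is a cone. *)
apply: (@acyclic_below_cone _ _ _ x) => A /andP[yA /andP[]].
rewrite /kcomplex !inE negb_or yx yA !subUset !sub1set xU => /= -> h.
rewrite setUCA setDU1 -setD1D; apply: has_kmatching_isolated => // w.
rewrite !inE negb_or => /andP[/andP[wy _] wU].
by apply: contra wy => /(leafx _ wU) ->.
Qed.

Lemma kcomplex_acyclic U k : forest E -> no_split_matching E U k ->
  acyclic_below F (#|U| - 2 * k) (kcomplex E U k).
Proof.
move=> forestE nsU; apply: kcomplex_acyclic_of_del => // x y.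
(* The induction is on the statement about [kcomplex_del]: if [y] has a second leaf, the link of [x]
   is again a deletion of [y], now over [U :\ x]. The vanishing for [kcomplex] on smaller sets
   follows as [IH]. *)
have [m] := ubnP #|U|; elim: m U k x y nsU => // m IHm U k x y nsU Um pU.
have IH (V : {set 'I_n}) l : #|V| < m -> no_split_matching E V l ->
    acyclic_below F (#|V| - 2 * l) (kcomplex E V l).
  move=> Vm nsV; apply: kcomplex_acyclic_of_del => // x1 y1 p1.
  exact: IHm nsV Vm p1.
rewrite ltnS in Um.
have [xU yU xy leafx [z leafz]] := pU.
have xy' : x != y by apply: contraTneq xy => ->; rewrite adj_irrefl.
case: k nsU => [|k] nsU.
  apply: (@acyclic_below_cone _ _ _ x) => A /andP[yA /andP[AU _]].
  rewrite /kcomplex_del /kcomplex !inE negb_or eq_sym xy' yA.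
  by rewrite subUset sub1set xU AU has_kmatching0.
have cU : #|U| = #|U :\ x :\ y|.+2.
  by rewrite (cardsD1 x U) (cardsD1 y (U :\ x)) xU !inE eq_sym xy' yU.
have nsD := no_split_matchingD simpleE pU nsU.
have nsx : no_split_matching E (U :\ x) k.+1.
  exact: no_split_matchingS (subD1set _ _) nsU.
have cx : #|U :\ x| = #|U :\ x :\ y|.+1 by rewrite (cardsD1 x U) xU in cU; case: cU.
apply: (@acyclic_below_link _ _ _ x).
- move=> A /andP[]; rewrite !inE negb_or => /andP[_ yA] /kcomplex_down kA.
  by rewrite /kcomplex_del yA.
- apply: eq_acyclic_below; first by move=> A; rewrite kcomplex_leaf.
  (* Two vertices and one matching edge are lost, so the bound is unchanged. *)
  have -> : #|U| - 2 * k.+1 = #|U :\ x :\ y| - 2 * k by rewrite cU mulnS.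
  by apply: IH => //; apply: ltnW; rewrite -cU.
apply: eq_acyclic_below; first by move=> A; rewrite kcomplex_del_link.
have -> : (#|U| - 2 * k.+1).-1 = #|U :\ x| - 2 * k.+1.
  by rewrite cU cx -subnS subSS.
have [/existsP[x' /and3P[x'U yx' /forall_inP leafx']]|noleaf] := boolP [exists x',
    [&& x' \in U :\ x, adj y x' & [forall w in U, adj x' w ==> (w == y)]]].
  apply: (IHm _ _ x' y nsx); first by rewrite cx -cU.
  split=> //; first by rewrite !inE eq_sym xy'.
  - by rewrite adj_sym.
  - by move=> w /setD1P[_ wU] x'w; have := leafx' w wU; rewrite x'w => /eqP.
  exists z => w /setD1P[_ wU] yw wz v /setD1P[_ vU]; exact: leafz.
(* Without a second leaf at [y], the pendant condition leaves [z] as the only possible neighbour of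
   [y] in [U :\ x]. *)
have nbry w : w \in U :\ x -> adj y w -> w = z.
  move=> wU yw; apply/eqP; apply: contraNT noleaf => /eqP wz.
  apply/existsP; exists w; rewrite wU yw; apply/forall_inP => v vU.
  apply/implyP => wv; apply/eqP/(leafz w) => //.
  by case/setD1P: wU.
(* If [W] misses all neighbours of [y], then [y] itself may be dropped, and [xy] forms a gap with
   every edge inside the rest. *)
have empty (W : {set 'I_n}) : W \subset U :\ x -> (forall w, w \in W -> ~~ adj y w) ->
    ~~ has_kmatching E k.+1 W.
  move=> WU noy; apply: contraNN.
    by apply: (has_kmatching_isolated simpleE noy).
  apply: (no_split_matching_edge simpleE xU yU xy _ _ nsU); first exact: setSD.
  move=> w /setD1P[wy wW]; split; last exact: noy.
  have /setD1P[_ wU] := subsetP WU w wW.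
  by apply: contra wy => /(leafx _ wU) ->.
have [/andP[zUx yz]|nyz] := boolP ((z \in U :\ x) && adj y z).
  have zy : z != y by apply: contraTneq yz => ->; rewrite adj_irrefl.
  have yUx : y \in U :\ x by rewrite !inE eq_sym xy'.
  (* In [U :\ x] the vertex [y] is now a leaf at [z], so the deletion of [z] is handled by
     [kcomplex_leaf] with [y] and [z] as the leaf edge. The link of [z] has no cells by [empty]. *)
  apply: (@acyclic_below_link _ _ _ z).
  - move=> A /andP[]; rewrite !inE negb_or => /andP[_ yA] /kcomplex_down kA.
    by rewrite /kcomplex_del yA.
  - apply: eq_acyclic_below.
      by move=> A; rewrite /kcomplex_del andbCA kcomplex_leaf.
    have cz : #|U :\ x :\ y| = #|U :\ x :\ y :\ z|.+1.
      by rewrite (cardsD1 z) inE zUx !inE zy.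
    have -> : #|U :\ x| - 2 * k.+1 = #|U :\ x :\ y :\ z| - 2 * k.
      by rewrite cx cz mulnS.
    apply: IH; first by rewrite cU cz in Um; do 2!apply: ltnW.
    exact: no_split_matchingS (subD1set _ _) nsD.
  apply: acyclic_below_empty => A; rewrite kcomplex_del_link //.
  apply/negbTE/negP => /andP[yA /andP[_]]; apply/negP/empty.
    exact: subset_trans (subsetDl _ _) (subD1set _ _).
  move=> w /setDP[/setD1P[wz wUx] _].
  by apply: contra wz => /(nbry _ wUx) ->.
apply: acyclic_below_empty => A; apply/negbTE/negP => /andP[yA /andP[_]].
apply/negP/empty; first exact: subsetDl.
move=> w /setDP[wUx _]; apply: contra nyz => yw.
by rewrite -(nbry _ wUx yw) wUx.
Qed.
End Vanishing.

(** * Admissible matchings *)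

Lemma exists_subset_card (T : finType) (A B : {set T}) m :
  A \subset B -> #|A| <= m <= #|B| ->
  exists C : {set T}, [/\ A \subset C, C \subset B & #|C| = m].
Proof.
have [d] := ubnP (m - #|A|); elim: d A => // d IHd A.
rewrite ltnS => md AB /andP[Am mB].
have [Em|neq] := eqVneq #|A| m; first by exists A.
have ltAm : #|A| < m by rewrite ltn_neqAle neq.
have /properP[_ [x xB xA]] : A \proper B.
  by rewrite properEcard AB (leq_trans ltAm).
have cxA : #|x |: A| = #|A|.+1 by rewrite cardsU1 xA.
have [|||C [xAC CB cC]] := IHd (x |: A).
- by rewrite cxA subnS -ltnS prednK // subn_gt0.
- by rewrite subUset sub1set xB.
- by rewrite cxA ltAm.
by exists C; split=> //; apply: subset_trans (subsetUr _ _) xAC.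
Qed.

Section AdmissibleMatchings.
Variables (n : nat) (E : {set {set 'I_n}}).
Hypothesis simpleE : simple_graph E.
Implicit Types (M : {set {set 'I_n}}) (k : nat).

Lemma exists_matching_card k : 0 < k -> k <= mat E ->
  exists2 M, matching E M & #|M| = k.
Proof.
move=> k0 kmat.
have [/existsP[M /andP[mM kM]]|noM] := boolP [exists M, matching E M && (k <= #|M|)].
  have [||C [_ CM cC]] := @exists_subset_card _ set0 M k; rewrite ?sub0set ?cards0 //.
  by exists C; first apply: matchingS mM.
suff : mat E < k by rewrite ltnNge kmat.
rewrite -(prednK k0) ltnS; apply/bigmax_leqP => M mM.
rewrite -ltnS (prednK k0) ltnNge; apply: contra noM => kM.
by apply/existsP; exists M; rewrite mM.
Qed.

Lemma sumn_blocks M (P : {set {set {set 'I_n}}}) : partition P M ->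
  sumn [seq #|Mi| | Mi : {set {set 'I_n}} <- enum P] = #|M|.
Proof. by move=> pP; rewrite sumnE big_map big_enum (card_partition pP). Qed.

(** Block sizes sum to [#|M|], which turns the numerical condition into a bound by [#|P|]; a cycle
    within a block would be a cycle of the forest. *)
Lemma kadm_matching_partition k M (P : {set {set {set 'I_n}}}) :
    forest E -> matching E M -> partition P M ->
    {in P &, forall Mi Mj : {set {set 'I_n}}, Mi != Mj -> {in Mi & Mj, forall e f, gap E e f}} ->
    #|M| <= #|P| + k - 1 ->
  kadm_matching E k M.
Proof.
move=> forestE mM pP gP cP; rewrite /kadm_matching mM /=.
apply/existsP; exists P; rewrite pP /=; apply/and3P; split.
- apply/forall_inP => Mi MiP; apply/forall_inP => Mj MjP; apply/implyP => neq.
  by apply/forall_inP => e eMi; apply/forall_inP => f; apply: gP neq e f eMi.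
- rewrite /kadm_seq (sumn_blocks pP) size_map -cardE cP andbT.
  apply/allP => _ /mapP[B BP ->]; rewrite card_gt0.
  by rewrite mem_enum in BP; apply: contraTneq BP => ->; case/and3P: pP.
apply/forall_inP => Mi _; apply: contraNN forestE; rewrite /has_cycle_in.
case/existsP=> m /existsP[s /and4P[us s3 _ cs]].
apply/existsP; exists m; apply/existsP; exists s; rewrite us s3 cs andbT.
by apply/allP => v; rewrite inE.
Qed.

Lemma leq_aim k : 0 < k -> forest E -> k <= mat E -> k <= aim E k.
Proof.
move=> k0 forestE /(exists_matching_card k0)[M mM cM].
rewrite -[leqLHS]cM; apply: leq_bigmax_cond.
apply: (@kadm_matching_partition k M [set M]) => //.
- apply/and3P; split; first by rewrite /cover big_set1.
    by apply/trivIsetP => A B /set1P-> /set1P->; rewrite eqxx.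
  by rewrite inE eq_sym -card_gt0 cM.
- by move=> A B /set1P-> /set1P->; rewrite eqxx.
by rewrite cards1 cM add1n subn1.
Qed.

Lemma no_split_matching_of_aim k U : forest E -> aim E k <= k ->
  no_split_matching E U k.
Proof.
move=> forestE aimk M1 M2 mM _ M10 M20 g cM.
have M12 e : e \in M1 -> e \notin M2.
  move=> e1; apply/negP => e2.
  have /card_gt0P[v ve] : 0 < #|e|.
    by rewrite (card_edge simpleE) // (matching_edge mM) // inE e1.
  by have /gapP/(_ v v ve ve)[] := g e e e1 e2; rewrite eqxx.
have neq12 : M1 != M2.
  apply: contraNneq M10 => E12; apply/set0Pn => -[e e1].
  by have := M12 e e1; rewrite -E12 e1.
have : #|M1 :|: M2| <= aim E k; last by rewrite cM leqNgt ltnS aimk.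
(* Two blocks admit size [2 + k - 1 = k.+1], exactly the size of the split matching. *)
apply: leq_bigmax_cond; apply: (@kadm_matching_partition _ _ [set M1; M2]) => //.
- apply/and3P; split.
  + by rewrite /cover big_setU1 ?big_set1 // inE.
  + have d12 : [disjoint M1 & M2].
      by apply/pred0P => e /=; apply/negbTE/negP => /andP[/M12/negP].
    apply/trivIsetP => A B /set2P[]-> /set2P[]->; rewrite ?eqxx // => _.
    by rewrite disjoint_sym.
  + by rewrite !inE negb_or ![set0 == _]eq_sym M10.
- move=> A B /set2P[]-> /set2P[]->; rewrite ?eqxx // => _ e f e2 f1.
  by rewrite gap_sym; apply: g.
by rewrite cards2 neq12 cM addSn subn1.
Qed.

Lemma split_matching_of_aim k : 0 < k -> k < aim E k ->
  exists M1 M2, [/\ matching E (M1 :|: M2), M1 != set0, M2 != set0,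
    {in M1 & M2, forall e f, gap E e f} & #|M1 :|: M2| = k.+1].
Proof.
move=> k0 kaim.
have [/existsP[M /andP[]]|noM] := boolP [exists M, kadm_matching E k M && (k < #|M|)];
    last first.
  case/negP: (ltnn k); apply: leq_trans kaim _; apply/bigmax_leqP => M aM.
  by rewrite leqNgt; apply: contra noM => kM; apply/existsP; exists M; rewrite aM.
case/andP=> mM /existsP[P /and4P[pP /forall_inP gP /andP[_ sumP] _]] kM.
have gap_blocks (B C : {set {set 'I_n}}) e f : B \in P -> C \in P -> B != C -> e \in B -> f \in C -> gap E e f.
  move=> BP CP neq eB fC; move/forall_inP: (gP B BP) => /(_ C CP)/implyP/(_ neq).
  by move/forall_inP/(_ e eB)/forall_inP/(_ f fC).
have [coverP tP P0] := and3P pP.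
(* A single block would bound the size of [M] by [k]. *)
have {sumP} /card_gt1P[B [C [BP CP neq]]] : 1 < #|P|.
  rewrite (sumn_blocks pP) size_map -cardE in sumP.
  rewrite ltnNge; apply: contraL (leq_trans kM sumP) => P1.
  by rewrite -leqNgt leq_subLR leq_add2r.
have nonempty (A : {set {set 'I_n}}) : A \in P -> exists e, e \in A.
  by move=> AP; apply/set0Pn; apply: contraNneq P0 => <-.
have [[e eB] [f fC]] := (nonempty B BP, nonempty C CP).
have inM (A : {set {set 'I_n}}) g : A \in P -> g \in A -> g \in M.
  by move=> AP gA; rewrite -(eqP coverP); apply/bigcupP; exists A.
have fB : f \notin B.
  by apply/negP; apply/negP; rewrite (disjointFl _ fC) //; exact: (trivIsetP tP).
(* Trimming to size [k.+1] keeps an edge from each of two blocks, so both sides of the split by [B]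
   stay nonempty; [0 < k] leaves room for both edges. *)
have [||N [efN NM cN]] := @exists_subset_card _ [set e; f] M k.+1.
- by rewrite subUset !sub1set (inM B) ?(inM C).
- rewrite kM andbT cards2 ltnS.
  exact: leq_trans (leq_b1 _) k0.
have UN : (N :&: B) :|: (N :\: B) = N by rewrite setID.
exists (N :&: B), (N :\: B); rewrite UN; split=> //.
- exact: matchingS mM.
- by apply/set0Pn; exists e; rewrite inE eB (subsetP efN) // !inE eqxx.
- by apply/set0Pn; exists f; rewrite inE fB (subsetP efN) // !inE eqxx orbT.
move=> e' f' /setIP[_ eB'] /setDP[fN' fB'].
have /bigcupP[C' CP' fC'] : f' \in cover P by rewrite (eqP coverP) (subsetP NM).
by apply: (gap_blocks B C') => //; apply: contraNneq fB' => ->.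
Qed.

End AdmissibleMatchings.

(** * Multigraded Betti numbers *)

Section Betti.
Variables (F : fieldType) (n : nat) (E : {set {set 'I_n}}).
Hypothesis simpleE : simple_graph E.
Implicit Types (M : {set {set 'I_n}}) (U V A : {set 'I_n}) (k : nat) (a : monom n).

Definition msupp a : {set 'I_n} := [set v | 0 < a v].

Definition monom_of_set U : monom n := [ffun v => (v \in U) : nat].

Lemma in_sqpowE k a : in_sqpow E k a = has_kmatching E k (msupp a).
Proof.
apply: eq_existsb => M; congr [&& _, _ & _].
by apply/forall_inP/subsetP => h v /h; rewrite inE.
Qed.

Lemma kbasis_sqpow k a A : kbasis (in_sqpow E k) a A =
  (A \subset msupp a) && has_kmatching E k [set v | (v \in A) < a v].
Proof.
rewrite /kbasis in_sqpowE; congr (_ && has_kmatching E k _).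
  by apply/forall_inP/subsetP => h v /h; rewrite inE.
by apply/setP=> v; rewrite !inE ffunE subn_gt0.
Qed.

Lemma kbasis_sqpow_down k a v A :
  kbasis (in_sqpow E k) a (v |: A) -> kbasis (in_sqpow E k) a A.
Proof.
rewrite !kbasis_sqpow subUset => /andP[/andP[_ ->]] /=.
apply: has_kmatchingS; apply/subsetP => w; rewrite !inE; apply: leq_ltn_trans.
by case: (w \in A); rewrite ?orbT.
Qed.

Lemma kbasis_squarefree k a : (forall v, a v <= 1) ->
  kbasis (in_sqpow E k) a =1 kcomplex E (msupp a) k.
Proof.
move=> a1 A; rewrite kbasis_sqpow; congr (_ && has_kmatching E k _).
apply/setP=> v; rewrite !inE; have := a1 v.
by case: (v \in A) => /=; case: (a v) => [|[]].
Qed.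

Lemma mdeg_squarefree a : (forall v, a v <= 1) -> mdeg a = #|msupp a|.
Proof.
move=> a1; rewrite /mdeg -sum1_card [RHS]big_mkcond; apply: eq_bigr => v _.
by rewrite inE; have := a1 v; case: (a v) => [|[]].
Qed.

Lemma msupp_of_set U : msupp (monom_of_set U) = U.
Proof. by apply/setP=> v; rewrite inE ffunE lt0b. Qed.

Lemma betti_sqpow_le k i a : forest E -> no_split_matching E setT k ->
  betti_nz F (in_sqpow E k) i a -> mdeg a <= i + 2 * k.
Proof.
move=> forestE nsT nz; rewrite leqNgt; apply/negP => lt_i; apply: nz.
apply/tor_dim_eq0P; first exact: kbasis_sqpow_down.
have [/forallP a1|/forallPn[v va]] := boolP [forall v, a v <= 1].
  apply: eq_exact_at; first by move=> A; rewrite kbasis_squarefree.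
  apply: kcomplex_acyclic => //; first exact: no_split_matchingS (subsetT _) nsT.
  by rewrite -mdeg_squarefree // ltn_subRL addnC.
(* If the exponent of [v] is at least 2, lowering it by 1 keeps [v] in the support, so [v] can join
   any cell. *)
rewrite -ltnNge in va; apply: (@acyclic_below_cone _ _ _ v i.+1) => // A.
rewrite !kbasis_sqpow subUset sub1set inE => /andP[-> h].
rewrite (ltn_trans _ va) //=; apply: has_kmatchingS h; apply/subsetP => w.
by rewrite !inE; case: eqP => [->|].
Qed.

Lemma betti_nz_of_set k i U : ~ exact_at F (kcomplex E U k) i ->
  betti_nz F (in_sqpow E k) i (monom_of_set U).
Proof.
move=> nex /tor_dim_eq0P ex; apply: nex.
rewrite -[U in kcomplex E U k]msupp_of_set.
apply: eq_exact_at (ex (@kbasis_sqpow_down k _)) => A.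
by rewrite kbasis_squarefree // => v; rewrite ffunE leq_b1.
Qed.

Lemma mdeg_of_set U : mdeg (monom_of_set U) = #|U|.
Proof. by rewrite mdeg_squarefree ?msupp_of_set // => v; rewrite ffunE leq_b1. Qed.

(** The class of a minimal generator: removing any vertex leaves fewer than [2 * k] vertices, so the
    empty set is the only cell and bounds nothing. *)
Lemma generator_not_exact k M : matching E M -> #|M| = k ->
  ~ exact_at F (kcomplex E (cover M) k) 0.
Proof.
move=> mM cM ex; pose c : {ffun {set 'I_n} -> F} := [ffun A => (A == set0)%:R%R].
have [A|| b bD bE] := ex c.
- rewrite ffunE; case: (eqVneq A set0) => [->|]; last by rewrite eqxx.
  rewrite cards0 /kcomplex sub0set setD0; split=> //; apply/has_kmatchingP.
  by exists M.
- apply/ffunP=> A; rewrite !ffunE big1 // => v _; rewrite ffunE.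
  have -> : (v |: A == set0) = false.
    by apply/negbTE/set0Pn; exists v; rewrite setU11.
  by rewrite mulr0.
have : c set0 = 1%R by rewrite ffunE eqxx.
rewrite -bE ffunE big1 => [/esym/eqP|v _]; first by rewrite oner_eq0.
have [->|/bD[/andP[vU /has_kmatchingP[M' [mM' cM' M'U]]] _]] := eqVneq (b (v |: set0)) 0%R.
  by rewrite mulr0.
have := subset_leq_card M'U; rewrite setU0 in vU *.
rewrite (card_cover_matching simpleE mM') cM' -cM.
rewrite -(card_cover_matching simpleE mM) (cardsD1 v (cover M)).
by rewrite -sub1set vU ltnn.
Qed.

Lemma has_kmatching_coverD1 k M v : matching E M -> #|M| = k.+1 ->
  v \in cover M -> has_kmatching E k (cover M :\ v).
Proof.
move=> mM cM /bigcupP[e eM ve]; apply/has_kmatchingP; exists (M :\ e); split.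
- exact: matchingS (subD1set _ _) mM.
- by have := cardsD1 e M; rewrite eM cM => -[].
rewrite subsetD1 coverS ?subD1set //=; apply/bigcupP => -[f /setD1P[fe fM] vf].
by case/eqP: fe; apply: matching_eq mM fM eM vf ve.
Qed.

(* A matching of size [k] missing one vertex of each side would pair up the odd
   number [2 * #|M1| - 1] of remaining vertices of [cover M1]. *)
Lemma split_matching_parity k M1 M2 v w :
    matching E (M1 :|: M2) -> {in M1 & M2, forall e f, gap E e f} ->
    #|M1 :|: M2| = k.+1 -> v \in cover M1 -> w \in cover M2 ->
  ~~ has_kmatching E k (cover (M1 :|: M2) :\ v :\ w).
Proof.
move=> mM g cM v1 w2; apply/has_kmatchingP => -[N [mN cN NV]].
have sep s t : s \in cover M1 -> t \in cover M2 -> s != t /\ ~~ adj E s t.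
  by case/bigcupP=> e eM se /bigcupP[f fM tf]; have /gapP := g e f eM fM; apply.
have coverN : cover N = cover (M1 :|: M2) :\ v :\ w.
  apply/eqP; rewrite eqEcard NV (card_cover_matching simpleE mN) cN.
  have vV : v \in cover (M1 :|: M2) by rewrite coverU inE v1.
  have wV : w \in cover (M1 :|: M2) :\ v.
    by rewrite in_setD1 eq_sym (proj1 (sep v w v1 w2)) coverU inE w2 orbT.
  have := cardsD1 v (cover (M1 :|: M2)); rewrite vV (cardsD1 w (_ :\ v)) wV.
  by rewrite (card_cover_matching simpleE mM) cM mulnS addnA => /addnI->; rewrite leqnn.
pose N1 := [set e in N | e \subset cover M1].
(* By counting, [N] covers everything except [v] and [w]; as no edge crosses between the sides, its
   edges inside [cover M1] cover all of that side but [v]. *)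
have coverN1 : cover N1 = cover M1 :\ v.
  apply/setP=> u; apply/bigcupP/setD1P => [[e]|[uv u1]].
    rewrite inE => /andP[eN e1] ue; split; last exact: (subsetP e1).
    by have := mem_cover eN ue; rewrite coverN => /setD1P[_ /setD1P[]].
  have /bigcupP[e eN ue] : u \in cover N.
    by rewrite coverN coverU !inE uv u1 (proj1 (sep u w u1 w2)).
  exists e => //; rewrite inE eN.
  have [u' uu' eE] := edge_other simpleE (matching_edge mN eN) ue.
  rewrite eE subUset !sub1set u1 /=.
  have : u' \in cover N by apply: (mem_cover eN); rewrite eE !inE eqxx orbT.
  rewrite coverN coverU => /setD1P[_ /setD1P[_ /setUP[//|u'2]]].
  by have [_ /negP] := sep u u' u1 u'2.
have mN1 : matching E N1.
  by apply: matchingS mN; apply/subsetP => e; rewrite inE => /andP[].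
have mM1 : matching E M1 by apply: matchingS mM; apply: subsetUl.
have := congr1 odd (cardsD1 v (cover M1)).
rewrite -coverN1 v1 (card_cover_matching simpleE mM1).
by rewrite (card_cover_matching simpleE mN1) oddD !oddM.
Qed.

(** Every vertex is a cell, but by parity no cell joins the two sides: the complex is disconnected,
    which gives homology in degree 1. *)
Lemma split_matching_not_exact k M1 M2 :
    matching E (M1 :|: M2) -> M1 != set0 -> M2 != set0 ->
    {in M1 & M2, forall e f, gap E e f} -> #|M1 :|: M2| = k.+1 ->
  ~ exact_at F (kcomplex E (cover (M1 :|: M2)) k) 1.
Proof.
move=> mM M10 M20 g cM ex.
have cover_neq0 M : M \subset M1 :|: M2 -> M != set0 -> exists v, v \in cover M.
  move=> MM /set0Pn[e eM].
  have eE : e \in E by apply: (matching_edge mM); apply: (subsetP MM).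
  have /card_gt0P[v ve] : 0 < #|e| by rewrite (card_edge simpleE eE).
  by exists v; apply: mem_cover ve.
have [p p1] := cover_neq0 M1 (subsetUl _ _) M10.
have [q q2] := cover_neq0 M2 (subsetUr _ _) M20.
have sep s t : s \in cover M1 -> t \in cover M2 -> s != t.
  case/bigcupP=> e eM se /bigcupP[f fM tf].
  by have /gapP/(_ s t se tf)[] := g e f eM fM.
have neqpq := sep p q p1 q2.
(* Up to sign, [bd d] is the difference of the vertices [p] and [q]. It is a cycle for free, while
   [[set p; q]] itself is not a cell. *)
pose d : {ffun {set 'I_n} -> F} := [ffun A => (A == [set p; q])%:R%R].
have dE v (B : {set 'I_n}) : v \notin B -> d (v |: B) != 0%R ->
    (v = p /\ B = [set q]) \/ (v = q /\ B = [set p]).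
  move=> vB; rewrite ffunE.
  case: (eqVneq (v |: B) [set p; q]) => [vBE _|]; last by rewrite eqxx.
  have BE : B = [set p; q] :\ v by rewrite -vBE setU1K.
  have /set2P[vE|vE] : v \in [set p; q] by rewrite -vBE setU11.
    by left; rewrite BE vE setU1K // inE.
  by right; rewrite BE vE setUC setU1K // inE eq_sym.
have bdE B : bd d B != 0%R -> B = [set p] \/ B = [set q].
  move=> nz; have [v vB] : exists2 v, v \notin B & d (v |: B) != 0%R.
    apply/exists_inP; apply: contraNT nz => /exists_inPn z.
    rewrite ffunE big1 // => v /z /negPn /eqP ->; exact: mulr0.
  by case/(dE v B vB) => -[_ ->]; [right|left].
have [A /bdE AE||b bD bE] := ex (bd d).
- suff [v vV ->] : exists2 v, v \in cover (M1 :|: M2) & A = [set v].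
    rewrite cards1 /kcomplex sub1set vV; split=> //.
    exact: has_kmatching_coverD1.
  rewrite coverU; case: AE => ->; [exists p | exists q] => //;
    by rewrite inE ?p1 ?q2 ?orbT.
- exact: bd_bd.
(* Restricting a bounding chain to the side of [M1] retains only the [p] term of its boundary, as no
   cell crosses. *)
pose b1 : {ffun {set 'I_n} -> F} :=
  [ffun A : {set 'I_n} => if A \subset cover M1 then b A else 0%R].
have bd1 v : bd b1 [set v] = if v \in cover M1 then bd d [set v] else 0%R.
  rewrite -bE !ffunE; case: ifPn => v1; last first.
    rewrite big1 // => w _; rewrite ffunE subUset !sub1set (negPf v1) andbF.
    exact: mulr0.
  apply: eq_bigr => w wv; rewrite ffunE subUset !sub1set v1 andbT.
  case: ifPn => // w1; congr (_ * _)%R; apply/esym/eqP.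
  apply: contraT => /bD[/andP[]]; rewrite coverU subUset !sub1set inE (negPf w1).
  case/andP=> /= w2 _; rewrite -coverU [w |: _]setUC setDU1 => h.
  by have := split_matching_parity mM g cM v1 w2; rewrite h.
(* At the empty set, [bd (bd b1)] is the augmentation of [bd b1]: it must vanish, yet its only term,
   at [p], is a unit. *)
have /ffunP/(_ set0) := bd_bd b1; rewrite !ffunE (bigD1 p) ?inE //= big1 => [|v].
  rewrite setU0 addr0 bd1 p1 => /eqP; rewrite mulf_eq0 /sg signr_eq0 /=.
  have qp : q \notin [set p] by rewrite inE eq_sym.
  rewrite ffunE (bigD1 q qp) /= big1 => [|v /andP[vp vq]].
    by rewrite addr0 ffunE setUC eqxx mulr1 /sg signr_eq0.
  apply/eqP; rewrite mulf_eq0 /sg signr_eq0 /=; apply: contraT => /(dE _ _ vp).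
  by case=> -[vE _]; rewrite vE ?inE eqxx in vp vq.
rewrite setU0 => /andP[_ vp]; rewrite bd1; case: ifPn => v1; last exact: mulr0.
suff -> : bd d [set v] = 0%R by rewrite mulr0.
apply/eqP/contraT => /bdE[] /set1_inj vE; first by rewrite vE eqxx in vp.
by have := sep v q v1 q2; rewrite vE eqxx.
Qed.

End Betti.

Theorem theorem5p10 (F : fieldType) (n k : nat) (E : {set {set 'I_n}}) :
  1 <= k ->
  simple_graph E -> forest E ->
  k <= mat E ->
  (is_reg F (in_sqpow E k) (Posz (2 * k)) <-> aim E k = k).
Proof.
move=> k1 simpleE forestE kmat; split=> [[_ reg_le]|aimk].
  apply/eqP; rewrite eqn_leq leq_aim // andbT leqNgt; apply/negP.
  (* The split matching gives a nonzero Betti number in homological degree 1 and total degree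
     [2 * k.+1], hence regularity at least [2 * k + 1]. *)
  case/(split_matching_of_aim k1) => M1 [M2 [mM M10 M20 g cM]].
  have := reg_le _ _ (betti_nz_of_set
    (split_matching_not_exact simpleE mM M10 M20 g cM)).
  rewrite mdeg_of_set (card_cover_matching simpleE mM) cM.
  by rewrite lerBlDr -PoszD lez_nat mulnS addnC leq_add2l.
have [M mM cM] := exists_matching_card k1 kmat; split.
  (* A minimal generator, of degree [2 * k], attains the value. *)
  exists 0, (monom_of_set (cover M)); split.
    exact/betti_nz_of_set/generator_not_exact.
  by rewrite mdeg_of_set (card_cover_matching simpleE mM) cM subr0.
move=> i a /(betti_sqpow_le simpleE forestE).
rewrite lerBlDr -PoszD lez_nat addnC; apply.
by apply: no_split_matching_of_aim; rewrite ?aimk.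
Qed.
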